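(* For all positive integers $m,n$ with $m<2^{n}+2-n$, $$\mathop{\mathrm{CT}}_{x}\,\Psi_{m+n}=\mathop{\mathrm{CT}}_{x}\,B^{m}\Psi_{n},$$ where the transfer matrix $B$ is $$B=\begin{pmatrix} x&0&0&0&0\\ 3&x+1&x&0&0\\ x^{-1}&x^{-1}+1&3&x+1&x\\ 0&0&x^{-1}&x^{-1}+1&3\\ 0&0&0&0&x^{-1}\end{pmatrix}.$$
   Context: For an integer $n\ge 0$, let $G_n(x):=\prod_{i=0}^{n-1}\left(1+x^{2^i+1}+x^{2^{i+1}+1}\right)$ (real, in fact integer, coefficients). For $i\in\{-2,-1,0,1,2\}$ put $\psi_n^{(i)}:=x^{i\cdot 2^n}\,G_n(x)\,G_n(x^{-1})$, a Laurent polynomial in $x$, and let $\Psi_n:=\left(\psi_n^{(-2)},\psi_n^{(-1)},\psi_n^{(0)},\psi_n^{(1)},\psi_n^{(2)}\right)^{\mathsf t}$ be the corresponding column vector. For a Laurent polynomial $L(x)=\sum_{i=M}^{N}a_ix^i$, $\mathop{\mathrm{CT}}_x L(x):=a_0$ denotes its constant term; $\mathop{\mathrm{CT}}_x$ is applied to vectors entrywise. *)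

(* Defs.v *)
From HB Require Import structures.
From mathcomp Require Import all_boot all_order all_algebra.
From mathcomp Require Import finmap.
From mathcomp.multinomials Require Import monalg.

Set Implicit Arguments.
Unset Strict Implicit.
Unset Printing Implicit Defensive.

Import GRing.Theory.
Local Open Scope fset_scope.
Local Open Scope ring_scope.

(* The ring R[x, x^-1], as finitely supported functions int -> R.  The ring   *)
(* structure of monalg.v is not available on {malg R[int]}: it requires a     *)
(* monoid of exponents without nontrivial units.  Hence the alias, which is   *)
(* given the convolution product below.                                       *)
Definition laurent (R : comNzRingType) : Type := {malg R[int]}.

HB.instance Definition _ (R : comNzRingType) := GRing.Zmodule.on (laurent R).

Section LaurentRing.
Variable R : comNzRingType.
Implicit Types (f g h : laurent R) (a b : R) (k l : int).

Definition lterm a k : laurent R := << a *g k >>.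
Definition lcoef k f : R := f@_k.

Definition lmul f g : laurent R :=
  \sum_(k <- msupp f) \sum_(l <- msupp g) lterm (lcoef k f * lcoef l g) (k + l).

Let lterm0 k : lterm 0 k = 0.
Proof. exact: monalgU0. Qed.

Let ltermD a b k : lterm (a + b) k = lterm a k + lterm b k.
Proof. exact: monalgUD. Qed.

Let lcoefD k f g : lcoef k (f + g) = lcoef k f + lcoef k g.
Proof. exact: mcoeffD. Qed.

Lemma lcoef_lterm a k l : lcoef l (lterm a k) = a *+ (k == l).
Proof. exact: mcoeffU. Qed.

Lemma laurentP f g : (forall k, lcoef k f = lcoef k g) <-> f = g.
Proof. exact: malgP. Qed.

Lemma laurentE f : f = \sum_(k <- msupp f) lterm (lcoef k f) k.
Proof. exact: monalgE. Qed.

Lemma lmulw (d e : {fset int}) f g : msupp f `<=` d -> msupp g `<=` e ->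
  lmul f g =
  \sum_(k <- d) \sum_(l <- e) lterm (lcoef k f * lcoef l g) (k + l).
Proof.
move=> le_d le_e; rewrite /lmul (big_fset_incl _ le_d) /=.
  apply: eq_bigr => k _; apply: big_fset_incl => // l _ gl.
  by rewrite [lcoef l g](mcoeff_outdom gl) mulr0 lterm0.
move=> k _ fk; rewrite big1 // => l _.
by rewrite [lcoef k f](mcoeff_outdom fk) mul0r lterm0.
Qed.

Lemma lmulC : commutative lmul.
Proof.
move=> f g; rewrite /lmul exchange_big /=.
by apply: eq_bigr => l _; apply: eq_bigr => k _; rewrite mulrC addrC.
Qed.

Lemma lmul_lterm a b k l :
  lmul (lterm a k) (lterm b l) = lterm (a * b) (k + l).
Proof.
rewrite (lmulw msuppU_le msuppU_le) !big_seq_fset1.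
by rewrite !lcoef_lterm !eqxx.
Qed.

Let lmul0f : left_zero 0 lmul.
Proof. by move=> g; rewrite /lmul msupp0 big_seq_fset0. Qed.

Lemma lmulDl : left_distributive lmul +%R.
Proof.
move=> f g h; have [sf sg] := (fsubsetUl (msupp f) (msupp g),
                               fsubsetUr (msupp f) (msupp g)).
have sh := fsubset_refl (msupp h).
rewrite (lmulw (msuppD_le f g) sh) (lmulw sf sh) (lmulw sg sh).
rewrite -big_split /=; apply: eq_bigr => k _.
by rewrite -big_split /=; apply: eq_bigr => l _; rewrite lcoefD mulrDl ltermD.
Qed.

Let lmulDr : right_distributive lmul +%R.
Proof. by move=> f g h; rewrite lmulC lmulDl !(lmulC f). Qed.

Let lmulf0 : right_zero 0 lmul.
Proof. by move=> f; rewrite lmulC lmul0f. Qed.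

Let lmul_suml (I : Type) (r : seq I) (F : I -> laurent R) g :
  lmul (\sum_(i <- r) F i) g = \sum_(i <- r) lmul (F i) g.
Proof.
exact: (big_morph (lmul^~ g) (fun f1 f2 => lmulDl f1 f2 g) (lmul0f g)).
Qed.

Let lmul_sumr (I : Type) (r : seq I) (F : I -> laurent R) f :
  lmul f (\sum_(i <- r) F i) = \sum_(i <- r) lmul f (F i).
Proof. exact: (big_morph (lmul f) (fun g1 g2 => lmulDr f g1 g2) (lmulf0 f)). Qed.

Lemma lmulA : associative lmul.
Proof.
move=> f g h; rewrite (laurentE f) (laurentE g) (laurentE h).
rewrite !lmul_suml; apply: eq_bigr => i _.
rewrite [LHS]lmul_sumr [X in lmul X _]lmul_sumr lmul_suml.
apply: eq_bigr => j _.
rewrite !lmul_sumr; apply: eq_bigr => k _.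
by rewrite !lmul_lterm mulrA addrA.
Qed.

Lemma lmul1 : left_id (lterm 1 0) lmul.
Proof.
move=> f; rewrite {1}(laurentE f) lmul_sumr [RHS]laurentE.
by apply: eq_bigr => k _; rewrite lmul_lterm mul1r add0r.
Qed.

Lemma laurent1_neq0 : lterm 1 0 != 0 :> laurent R.
Proof.
apply/eqP => /laurentP/(_ 0); rewrite lcoef_lterm eqxx => /eqP.
by rewrite [lcoef 0 0]mcoeff0 oner_eq0.
Qed.

HB.instance Definition _ := GRing.Zmodule_isComNzRing.Build (laurent R)
  lmulA lmulC lmul1 lmulDl laurent1_neq0.

Definition xpow k : laurent R := lterm 1 k.

Lemma xpow0 : xpow 0 = 1. Proof. by []. Qed.

Lemma xpowD k l : xpow (k + l) = xpow k * xpow l.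
Proof. by rewrite [RHS]lmul_lterm mulr1. Qed.

Lemma xpowX k n : xpow (k *+ n) = xpow k ^+ n.
Proof. by elim: n => // n IHn; rewrite mulrS xpowD IHn exprS. Qed.

Definition CT f : R := lcoef 0 f.

End LaurentRing.

Definition G (A : comNzRingType) (n : nat) (u : A) : A :=
  \prod_(i < n) (1 + u ^+ (2 ^ i + 1) + u ^+ (2 ^ i.+1 + 1)).

Local Notation x := (xpow int 1).
Local Notation x' := (xpow int (-1)).

Definition psi (n : nat) (i : int) : laurent int :=
  xpow int (i * (2 ^ n)%N%:Z) * G n x * G n x'.

Definition Psi (n : nat) : 'cV[laurent int]_5 :=
  \col_(i < 5) psi n (i%:Z - 2).

Definition B : 'M[laurent int]_5 :=
  \matrix_(i < 5, j < 5)
    nth 0 (nth [::]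
      [:: [:: x;  0;      0;      0;      0 ];
          [:: 3;  x + 1;  x;      0;      0 ];
          [:: x'; x' + 1; 3;      x + 1;  x ];
          [:: 0;  0;      x';     x' + 1; 3 ];
          [:: 0;  0;      0;      0;      x'] ] i) j.

(* Main.v *)
Require Import Defs.
From mathcomp Require Import all_boot all_order all_algebra.
From mathcomp Require Import zify ring.

Set Implicit Arguments.
Unset Strict Implicit.
Unset Printing Implicit Defensive.

Import GRing.Theory.
Local Open Scope ring_scope.

(** The recursion G_{n+1}(u) = G_n(u) (1 + u^(2^n+1) + u^(2^(n+1)+1)) gives, for
    every integer i,
      psi_{n+1}^(i) = 3 psi_n^(2i) + (x+1) psi_n^(2i+1) + x psi_n^(2i+2)
                      + (x^-1+1) psi_n^(2i-1) + x^-1 psi_n^(2i-2)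
    (lemma [psi_rec]).  The matrix B records these coefficients for |i| <= 2,
    leaving out the terms psi_n^(j) with |j| >= 3.  Since psi_n^(0) has exponents
    of absolute value at most 2^(n+1) - 2 + n, the left-out psi_n^(j) only has
    exponents of absolute value at least 2^n + 2 - n ([psi_far]): they are far
    from the constant term.  So Psi_{n+1} and B Psi_n differ by a vector whose
    entries vanish in a window of exponents around 0 ([Psi_step]).

    Entries of B are combinations of x^-1, 1 and x, so one multiplication by B
    shrinks such a window by at most one on each side ([B_shrinks_gap]).  The
    errors created at later stages have windows that are exponentially wider, so
    the first one decides: Psi_{m+n} - B^m Psi_n vanishes at all exponents of
    absolute value at most 2^n + 1 - n - m ([Psi_sub_B_gap]), and this window
    contains 0 exactly when m < 2^n + 2 - n. *)

(** * Supports of Laurent polynomials *)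

Section Support.
Variable R : comNzRingType.
Implicit Types (f g : laurent R) (a d : nat) (k l : int).

Definition supp_within a f := forall k, (a < `|k|)%N -> lcoef k f = 0.

Definition supp_beyond d f := forall k, (`|k| <= d)%N -> lcoef k f = 0.

Lemma lcoefD k f g : lcoef k (f + g) = lcoef k f + lcoef k g.
Proof. exact: monalg.mcoeffD. Qed.

Lemma lcoef0 k : lcoef k (0 : laurent R) = 0.
Proof. exact: monalg.mcoeff0. Qed.

Lemma lcoefB k f g : lcoef k (f - g) = lcoef k f - lcoef k g.
Proof. exact: monalg.mcoeffB. Qed.

Lemma lcoef_xpowM k l f : lcoef k (xpow R l * f) = lcoef (k - l) f.
Proof.
rewrite {1}(laurentE f) mulr_sumr [in RHS](laurentE f).
have lcoef_sum j (r : seq int) (F : int -> laurent R) :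
    lcoef j (\sum_(i <- r) F i) = \sum_(i <- r) lcoef j (F i).
  exact: (big_morph (lcoef j) (lcoefD j) (lcoef0 j)).
rewrite !lcoef_sum; apply: eq_bigr => i _.
rewrite [_ * _]lmul_lterm mul1r !lcoef_lterm.
by congr (_ *+ nat_of_bool _); apply/eqP/eqP; lia.
Qed.

Lemma supp_beyondD d f g :
  supp_beyond d f -> supp_beyond d g -> supp_beyond d (f + g).
Proof. by move=> sf sg k hk; rewrite lcoefD sf ?sg ?addr0. Qed.

Lemma supp_beyondMn d f n : supp_beyond d f -> supp_beyond d (f *+ n).
Proof.
move=> sf; elim: n => [|n IHn]; first by move=> k _; rewrite mulr0n lcoef0.
by rewrite mulrS; apply: supp_beyondD.
Qed.

Lemma supp_beyondW d d' f :
  (d' <= d)%N -> supp_beyond d f -> supp_beyond d' f.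
Proof. by move=> led sf k hk; apply: sf; apply: leq_trans led. Qed.

Lemma supp_beyond_xpowM d l f :
  supp_beyond (d + `|l|)%N f -> supp_beyond d (xpow R l * f).
Proof. by move=> sf k hk; rewrite lcoef_xpowM; apply: sf; lia. Qed.

Lemma supp_withinD a f g :
  supp_within a f -> supp_within a g -> supp_within a (f + g).
Proof. by move=> sf sg k hk; rewrite lcoefD sf ?sg ?addr0. Qed.

Lemma supp_withinMn a f n : supp_within a f -> supp_within a (f *+ n).
Proof.
move=> sf; elim: n => [|n IHn]; first by move=> k _; rewrite mulr0n lcoef0.
by rewrite mulrS; apply: supp_withinD.
Qed.

Lemma supp_withinW a a' f :
  (a <= a')%N -> supp_within a f -> supp_within a' f.
Proof. by move=> lea sf k hk; apply: sf; apply: leq_ltn_trans hk. Qed.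

Lemma supp_within_xpowM a l f :
  supp_within a f -> supp_within (a + `|l|)%N (xpow R l * f).
Proof. by move=> sf k hk; rewrite lcoef_xpowM; apply: sf; lia. Qed.

(** A long shift pushes a bounded support off a neighbourhood of 0. *)
Lemma supp_beyond_shift a d l f : (a + d < `|l|)%N ->
  supp_within a f -> supp_beyond d (xpow R l * f).
Proof. by move=> ltl sf k hk; rewrite lcoef_xpowM; apply: sf; lia. Qed.

End Support.

Local Notation x := (xpow int 1).
Local Notation x' := (xpow int (-1)).

(** * The recursion behind the transfer matrix *)

Lemma G0 (A : comNzRingType) (u : A) : G 0 u = 1.
Proof. exact: big_ord0. Qed.

Lemma G_rec (A : comNzRingType) n (u : A) :
  G n.+1 u = G n u * (1 + u * u ^+ (2 ^ n) + u * u ^+ (2 ^ n) ^+ 2).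
Proof. by rewrite /G big_ord_recr /= -!exprM -!exprS !addn1 expnSr. Qed.

Lemma psi_shift n i j :
  psi n (i + j) = xpow int (i * (2 ^ n)%N%:Z) * psi n j.
Proof. by rewrite /psi mulrDl xpowD !mulrA. Qed.

(** With y = x^(2^n), the factor G_{n+1}(x) G_{n+1}(x^-1) / (G_n(x) G_n(x^-1))
    is a polynomial in y and y^-1 with coefficients in x and x^-1, and multiplying
    by y^j is the same as raising the upper index of psi_n by j. *)
Lemma psi_rec n i :
  psi n.+1 i = psi n (2 * i) *+ 3
    + (x * psi n (2 * i + 1) + psi n (2 * i + 1)) + x * psi n (2 * i + 2)
    + (x' * psi n (2 * i - 1) + psi n (2 * i - 1)) + x' * psi n (2 * i - 2).
Proof.
pose y := x ^+ (2 ^ n); pose y' := x' ^+ (2 ^ n).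
have xx' : x * x' = 1 by rewrite -xpowD.
have yy' : y * y' = 1 by rewrite -exprMn xx' expr1n.
have yE : xpow int (2 ^ n)%N%:Z = y by rewrite /y -xpowX; congr xpow; lia.
have y'E : xpow int (- (2 ^ n)%N%:Z) = y'.
  by rewrite /y' -xpowX; congr xpow; rewrite mulNrn; lia.
have shift j : psi n (2 * i + j) = xpow int (j * (2 ^ n)%N%:Z) * psi n (2 * i).
  by rewrite addrC psi_shift.
have -> : psi n.+1 i = psi n (2 * i) *
    ((1 + x * y + x * y ^+ 2) * (1 + x' * y' + x' * y' ^+ 2)).
  rewrite /psi !G_rec -/y -/y'.
  have -> : i * (2 ^ n.+1)%N%:Z = 2 * i * (2 ^ n)%N%:Z.
    by rewrite expnS PoszM; ring.
  by rewrite [X in X * _ = _]mulrA mulrACA.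
rewrite !shift mul1r mulN1r.
have -> : xpow int (2 * (2 ^ n)%N%:Z) = y ^+ 2.
  by rewrite -yE -xpowX; congr xpow; lia.
have -> : xpow int (- 2 * (2 ^ n)%N%:Z) = y' ^+ 2.
  by rewrite -y'E -xpowX; congr xpow; lia.
rewrite yE y'E.
by ring: xx' yy'.
Qed.

(** * Size of the truncation error *)

(** The bound is the degree of G_n, namely the sum of 2^(i+1) + 1 for i < n. *)
Lemma psi0_supp n : supp_within (2 ^ n.+1 - 2 + n)%N (psi n 0).
Proof.
elim: n => [|n IHn].
  have -> : psi 0 0 = xpow int 0 by rewrite /psi !G0 !mulr1.
  move=> k hk.
  by rewrite lcoef_lterm; case: eqP => // k0; move: hk; rewrite -k0.
have le_psi l j : (`|l| + `|j| * 2 ^ n <= 2 ^ n.+1 + 1)%N ->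
    supp_within (2 ^ n.+2 - 2 + n.+1)%N (xpow int l * psi n j).
  move=> hlj; rewrite -(addr0 j) psi_shift mulrA -xpowD.
  apply: (supp_withinW _ (supp_within_xpowM IHn)).
  have := expnS 2 n; have := expnS 2 n.+1; have := expn_gt0 2 n.
  have : (absz (l + j * (2 ^ n)%N%:Z)%R <= `|l| + `|j| * 2 ^ n)%N.
    by rewrite -[X in (_ + _ * X)%N]absz_nat -abszM; lia.
  lia.
have le_psi1 j : (`|j| * 2 ^ n <= 2 ^ n.+1 + 1)%N ->
    supp_within (2 ^ n.+2 - 2 + n.+1)%N (psi n j).
  move=> hj; have -> : psi n j = xpow int 0 * psi n j by rewrite xpow0 mul1r.
  exact: (le_psi 0 j hj).
rewrite psi_rec mulr0 !add0r.
have e1 := expn_gt0 2 n; have e2 := expnS 2 n.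
refine (supp_withinD (supp_withinD (supp_withinD (supp_withinD
  (supp_withinMn 3 (le_psi1 0 _)) (supp_withinD (le_psi 1 1 _) (le_psi1 1 _)))
  (le_psi 1 2 _)) (supp_withinD (le_psi (-1) (-1) _) (le_psi1 (-1) _)))
  (le_psi (-1) (-2) _)); lia.
Qed.

(** The shift by at least 3 * 2^n outweighs the radius 2^(n+1) - 2 + n of the
    support of psi_n^(0). *)
Lemma psi_far n j : (2 < `|j|)%N -> supp_beyond (2 ^ n + 1 - n)%N (psi n j).
Proof.
move=> lt2j; rewrite -(addr0 j) psi_shift.
apply: (supp_beyond_shift _ (@psi0_supp n)).
have := ltn_expl n (ltnSn 1); have := expnS 2 n.
by rewrite abszM absz_nat; nia.
Qed.

(** One less than the bound of [psi_far], because the coefficients of the terms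
    left out by B involve x and x^-1. *)
Lemma Psi_step n i :
  supp_beyond (2 ^ n - n)%N ((Psi n.+1 - B *m Psi n) i ord0).
Proof.
have far (j : int) : (2 < `|j|)%N -> supp_beyond (2 ^ n - n)%N (psi n j).
  by move=> lt2j; apply: (supp_beyondW _ (psi_far lt2j)); lia.
have xfar (l j : int) : (`|l| = 1)%N -> (2 < `|j|)%N ->
    supp_beyond (2 ^ n - n)%N (xpow int l * psi n j).
  move=> l1 lt2j; apply: supp_beyond_xpowM.
  apply: (supp_beyondW _ (psi_far lt2j)); rewrite l1.
  by have := ltn_expl n (ltnSn 1); lia.
rewrite !mxE !big_ord_recl big_ord0 !mxE psi_rec.
move: (psi n) far xfar => p far xfar.
(* In the outermost rows four of the psi_n^(j) are left out, in
   the next ones two, and in the middle row none. *)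
case: i => [[|[|[|[|[|//]]]]] ?] /=; rewrite /bump /=.
- rewrite [X in supp_beyond _ X](_ : _ = p (-4) *+ 3 + (x * p (-3) + p (-3))
    + (x' * p (-5) + p (-5)) + x' * p (-6)); last by ring.
  exact (supp_beyondD (supp_beyondD (supp_beyondD
    (supp_beyondMn 3 (far (-4) isT))
    (supp_beyondD (xfar 1 (-3) erefl isT) (far (-3) isT)))
    (supp_beyondD (xfar (-1) (-5) erefl isT) (far (-5) isT)))
    (xfar (-1) (-6) erefl isT)).
- rewrite [X in supp_beyond _ X](_ : _ = (x' * p (-3) + p (-3)) + x' * p (-4));
    last by ring.
  exact (supp_beyondD (supp_beyondD (xfar (-1) (-3) erefl isT) (far (-3) isT))
    (xfar (-1) (-4) erefl isT)).
- rewrite [X in supp_beyond _ X](_ : _ = 0); last by ring.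
  by move=> k _; rewrite lcoef0.
- rewrite [X in supp_beyond _ X](_ : _ = (x * p 3 + p 3) + x * p 4);
    last by ring.
  exact (supp_beyondD (supp_beyondD (xfar 1 3 erefl isT) (far 3 isT))
    (xfar 1 4 erefl isT)).
- rewrite [X in supp_beyond _ X](_ : _ = p 4 *+ 3 + (x * p 5 + p 5)
    + (x' * p 3 + p 3) + x * p 6); last by ring.
  exact (supp_beyondD (supp_beyondD (supp_beyondD
    (supp_beyondMn 3 (far 4 isT))
    (supp_beyondD (xfar 1 5 erefl isT) (far 5 isT)))
    (supp_beyondD (xfar (-1) 3 erefl isT) (far 3 isT))) (xfar 1 6 erefl isT)).
Qed.

(** * Propagation of the error *)

(** Lets an argument about B treat six values instead of twenty-five positions. *)
Lemma B_entry (P : laurent int -> Prop) :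
  P 0 -> P 3 -> P x -> P x' -> P (x + 1) -> P (x' + 1) -> forall i j, P (B i j).
Proof.
move=> P0 P3 Px Px' Px1 Px'1 i j; rewrite mxE.
case: i j => [[|[|[|[|[|//]]]]] ?] [[|[|[|[|[|//]]]]] ?] /=;
(* The match is syntactic: comparing entries up to conversion would unfold the
   convolution product. *)
match goal with H : ?Q |- ?Q => exact H end.
Qed.

Lemma B_shrinks_gap d (v : 'cV[laurent int]_5) :
  (forall i, supp_beyond d.+1 (v i ord0)) ->
  forall i, supp_beyond d ((B *m v) i ord0).
Proof.
move=> sv i; rewrite mxE.
have s0 : supp_beyond d (0 : laurent int) by move=> k _; rewrite lcoef0.
apply: (big_ind (fun f => supp_beyond d f)) => // [f g|j _].
  exact: supp_beyondD.
have s1 : supp_beyond d (v j ord0) by apply: (supp_beyondW _ (sv j)).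
have sx l : (`|l| = 1)%N -> supp_beyond d (xpow int l * v j ord0).
  by move=> l1; apply: supp_beyond_xpowM; rewrite l1 addn1.
apply: (@B_entry (fun c => supp_beyond d (c * v j ord0))).
- by rewrite mul0r.
- by rewrite mulr_natl; apply: supp_beyondMn.
- exact: sx.
- exact: sx.
- by rewrite mulrDl mul1r; apply: (supp_beyondD (sx 1 erefl) s1).
- by rewrite mulrDl mul1r; apply: (supp_beyondD (sx (-1) erefl) s1).
Qed.

(** For m = 0 the difference is zero; from then on the window is dictated by the
    error of the first step, reduced by one at each multiplication by B. *)
Lemma Psi_sub_B_gap m n i : (m + n <= 2 ^ n + 1)%N ->
  supp_beyond (2 ^ n + 1 - (m + n))%N ((Psi (m + n) - B ^+ m *m Psi n) i ord0).
Proof.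
elim: m i => [|m IHm] i le_mn.
  by rewrite expr0 mul1mx subrr mxE => k _; rewrite lcoef0.
have -> : Psi (m.+1 + n) - B ^+ m.+1 *m Psi n =
    (Psi (m + n).+1 - B *m Psi (m + n)) + B *m (Psi (m + n) - B ^+ m *m Psi n).
  by rewrite mulmxBr mulmxA addrA subrK exprS.
rewrite mxE; apply: supp_beyondD.
  apply: (supp_beyondW _ (@Psi_step _ i)).
  have : (2 ^ n + m <= 2 ^ (m + n))%N.
    by rewrite expnD; have := ltn_expl m (ltnSn 1); have := expn_gt0 2 n; nia.
  lia.
apply: B_shrinks_gap => j.
by apply: (supp_beyondW _ (IHm j _)); lia.
Qed.

Theorem theorem3p4 (m n : nat) (m_gt0 : (0 < m)%N) (n_gt0 : (0 < n)%N)
    (ltm : (m < 2 ^ n + 2 - n)%N) :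
  map_mx (@CT int) (Psi (m + n)) = map_mx (@CT int) (B ^+ m *m Psi n).
Proof.
apply/colP => i; rewrite mxE [RHS]mxE; apply/eqP; rewrite -subr_eq0; apply/eqP.
rewrite /CT -lcoefB.
have le_mn : (m + n <= 2 ^ n + 1)%N by lia.
by have := @Psi_sub_B_gap m n i le_mn 0 isT; rewrite mxE [X in _ + X]mxE.
Qed.
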